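(* Let $Z$ be a real random variable whose distribution is symmetric about $0$, with mean $0$ and variance $1$, and let $u,v$ be real numbers with $0<v\leq u$. (1) If $0<v\leq u\leq 1$, then $$P(Z\leq -u \text{ or } Z\geq v)\leq 1,$$ with equality if $Z$ puts mass $1/2$ at both $1$ and $-1$. (2) If $0<v\leq u\leq \sqrt{2}\,v$ and $1\leq u$, then $$P(Z\leq -u \text{ or } Z\geq v)\leq \frac{1}{u^2},$$ with equality if $Z$ takes the values $-u,0,u$ with probabilities $\frac{1}{2u^2}$, $1-\frac{1}{u^2}$, $\frac{1}{2u^2}$, respectively. (3) If $0<v\leq 1<u$ and $\sqrt{2}\,v\leq u$, then $$P(Z\leq -u \text{ or } Z\geq v)\leq \frac12+\frac{1-v^2}{2(u^2-v^2)},$$ with equality if $Z$ takes each of the values $-u$ and $u$ with probability $\frac{1-v^2}{2(u^2-v^2)}$ and each of the values $-v$ and $v$ with probability $\frac{u^2-1}{2(u^2-v^2)}$. (4) If $1\leq v\leq u$ and $\sqrt{2}\,v\leq u$, then $$P(Z\leq -u \text{ or } Z\geq v)\leq \frac{1}{2v^2},$$ with equality if $Z$ takes the values $-v,0,v$ with probabilities $\frac{1}{2v^2}$, $1-\frac{1}{v^2}$, $\frac{1}{2v^2}$, respectively.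
   Context: A random variable $Z$ is symmetric (about $0$) if $Z$ and $-Z$ have the same distribution. *)

(* Defs.v *)
From HB Require Import structures.
From mathcomp Require Import all_boot all_order all_algebra.
From mathcomp Require Import all_classical all_reals all_analysis.

Set Implicit Arguments.
Unset Strict Implicit.
Unset Printing Implicit Defensive.

Import Order.TTheory GRing.Theory Num.Theory.
Import numFieldNormedType.Exports.

Local Open Scope classical_set_scope.
Local Open Scope ring_scope.

(* [distribution] is [pushforward] restricted to bundled measurable functions,
   and [\- Z] is not bundled. *)
Definition symmetric_rv (d : measure_display) (T : measurableType d)
    (R : realType) (P : probability T R) (Z : {RV P >-> R}) : Prop :=
  forall A : set R, measurable A ->
    distribution P Z A = pushforward P (\- Z) A.

(* No integrability assumption is needed: since +oo - +oo = -oo in [\bar R],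
   a null mean forces integrability, and then ['V_P[Z]] is the integral of the
   square of Z, so that its value 1 forces square integrability. *)
Definition std_symmetric_rv (d : measure_display) (T : measurableType d)
    (R : realType) (P : probability T R) (Z : {RV P >-> R}) : Prop :=
  [/\ symmetric_rv Z, ('E_P[Z] = 0)%E & ('V_P[Z] = 1)%E].

(* When the second components of [m] sum to 1 and its first components are
   pairwise distinct, this determines the distribution of Z. *)
Definition has_masses (d : measure_display) (T : measurableType d)
    (R : realType) (P : probability T R) (Z : {RV P >-> R})
    (m : seq (R * R)) : Prop :=
  forall x p : R, (x, p) \in m -> pmf Z x = p.

(* [m] describes the law of some symmetric random variable with mean 0 and
   variance 1, so that equality under [has_masses Z m] is not vacuous. *)
Definition std_symmetric_masses (R : realType) (m : seq (R * R)) : Prop :=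
  exists (d : measure_display) (T : measurableType d) (P : probability T R)
    (Z : {RV P >-> R}), std_symmetric_rv Z /\ has_masses Z m.

(* Main.v *)
Require Import Defs.
From HB Require Import structures.
From mathcomp Require Import all_boot all_order all_algebra.
From mathcomp Require Import all_classical all_reals all_analysis.
From mathcomp Require Import measurable_realfun.
From mathcomp Require Import ring lra.

Import Order.TTheory GRing.Theory Num.Theory.
Import numFieldNormedType.Exports.

Local Open Scope classical_set_scope.
Local Open Scope ring_scope.

(** The event is {Z in S} with S = ]-oo, -u] U [v, +oo[. By symmetry its
    probability is the mean of (1_S(Z) + 1_S(-Z)) / 2, a function of |Z| that
    is 0 below v, 1/2 from v up to u, and 1 from u on. If an even quadratic
    a + b x^2 dominates this step function then, Z having second moment 1,
    the probability is at most a + b [symmetrized_chebyshev]. For a, b >= 0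
    domination only has to be checked at the two jumps v and u
    [two_sided_tail_le], and each of the four bounds comes from one choice of
    (a, b):
    - (1, 0), the trivial bound;
    - (0, 1 / u^2), which meets the jump at u and clears 1/2 at v exactly
      when u <= sqrt 2 * v;
    - the quadratic through (v, 1/2) and (u, 1), whose constant term is
      nonnegative exactly when sqrt 2 * v <= u;
    - (0, 1 / (2 v^2)), which meets the jump at v and clears 1 at u exactly
      when sqrt 2 * v <= u.

    For equality, the atoms prescribed inside S already carry the whole bound,
    so that the lower bound P(Z in S) >= sum of the atoms in S
    [sum_pmf_le] suffices. All the extremal laws are mixtures of the
    uniform laws on {a, -a} and on {b, -b}; one construction on the real line
    shows that they exist [four_point_std_symmetric_masses]. *)

(** * Upper bound by quadratic majorants *)

Lemma std_second_moment {R : realType} {d : measure_display}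
    {T : measurableType d} {P : probability T R} (Z : {RV P >-> R}) :
  ('E_P[Z] = 0 -> 'V_P[Z] = \int[P]_w (Z w ^+ 2)%:E)%E.
Proof.
move=> EZ0; rewrite /variance covariance.unlock EZ0 expectation.unlock.
by apply: eq_integral => w _; rewrite fctE /= !subr0 expr2.
Qed.

(** By symmetry 2 P(Z in S) is the integral of 1_S(Z) + 1_S(-Z), hence at
    most that of 2 (a + b Z^2), which is 2 (a + b). Symmetrizing first is what
    gains over Chebyshev: S itself need not be symmetric. *)
Lemma symmetrized_chebyshev {R : realType} {d : measure_display}
    {T : measurableType d} {P : probability T R} (Z : {RV P >-> R})
    (S : set R) (a b : R) :
  std_symmetric_rv Z -> measurable S -> 0 <= a -> 0 <= b ->
  (forall x, \1_S x + \1_S (- x) <= 2 * (a + b * x ^+ 2)) ->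
  (P (Z @^-1` S) <= (a + b)%:E)%E.
Proof.
move=> [symZ EZ VZ] mS a0 b0 dom.
have mZ : measurable_fun setT Z by [].
have mNZ : measurable_fun setT (\- Z) by exact: measurableT_comp.
have mZS : measurable (Z @^-1` S).
  by rewrite -[X in measurable X]setTI; exact: mZ.
have mNZS : measurable ((\- Z) @^-1` S).
  by rewrite -[X in measurable X]setTI; exact: mNZ.
have Z2 : (\int[P]_w (Z w ^+ 2)%:E = 1)%E by rewrite -std_second_moment.
have mZ2 : measurable_fun setT (fun w => (Z w ^+ 2)%:E : \bar R).
  by apply/measurable_EFinP; exact: measurable_funX.
have bound : (\int[P]_w (2 * (a + b * Z w ^+ 2))%:E = (2 * (a + b))%:E)%E.
  under eq_integral => w _ do rewrite EFinM (EFinD a) (EFinM b).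
  rewrite ge0_integralZl_EFin//=.
  - rewrite ge0_integralD//=; last 2 first.
    + by move=> w _; rewrite -EFinM lee_fin mulr_ge0 ?sqr_ge0.
    + by apply: measurable_funeM.
    rewrite integral_cst// ge0_integralZl_EFin//=; last first.
      by move=> w _; rewrite lee_fin sqr_ge0.
    by rewrite Z2 probability_setT !mule1.
  - by move=> w _; rewrite -EFinM -EFinD lee_fin addr_ge0// mulr_ge0// sqr_ge0.
  - by apply: emeasurable_funD => //; exact: measurable_funeM.
have sumZ : (P (Z @^-1` S) + P (Z @^-1` S) <= (2 * (a + b))%:E)%E.
  rewrite -bound {2}(symZ _ mS : P (Z @^-1` S) = P ((\- Z) @^-1` S)).
  rewrite -[Z @^-1` S]setIT -[(\- Z) @^-1` S]setIT -!integral_indic//.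
  rewrite -ge0_integralD//; last 2 first.
  - by apply/measurable_EFinP; exact: measurable_indic.
  - by apply/measurable_EFinP; exact: measurable_indic.
  apply: ge0_le_integral => //.
  - by move=> w _; rewrite adde_ge0// lee_fin.
  - by apply: emeasurable_funD;
      apply/measurable_EFinP; exact: measurable_indic.
  - apply/measurable_EFinP; apply: measurable_funM => //.
    apply: measurable_funD => //; apply: measurable_funM => //.
    exact: measurable_funX.
  - by move=> w _; rewrite -EFinD lee_fin; exact: dom.
have Pfin : P (Z @^-1` S) \is a fin_num by exact: fin_num_measure.
move: sumZ; rewrite -(fineK Pfin) -EFinD !lee_fin; lra.
Qed.

Definition outside {R : realType} (u v : R) : set R :=
  [set x | x <= - u \/ v <= x].

Lemma measurable_outside {R : realType} (u v : R) : measurable (outside u v).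
Proof.
have -> : outside u v = `]-oo, - u]%classic `|` `[v, +oo[%classic.
  by apply/seteqP; split => x /=; rewrite !in_itv /= andbT.
exact: measurableU.
Qed.

(** For |x| < v neither x nor -x is in S; for v <= |x| < u exactly one of them
    is; and a + b x^2 increases with |x|, so that the two jumps are the only
    points to check. *)
Lemma two_sided_tail_le {R : realType} {d : measure_display}
    {T : measurableType d} {P : probability T R} (Z : {RV P >-> R})
    (u v a b : R) :
  std_symmetric_rv Z -> 0 < v -> v <= u -> 0 <= a -> 0 <= b ->
  1 / 2 <= a + b * v ^+ 2 -> 1 <= a + b * u ^+ 2 ->
  (P (Z @^-1` outside u v) <= (a + b)%:E)%E.
Proof.
move=> hZ v0 vu a0 b0 atv atu.
apply: symmetrized_chebyshev => //; first exact: measurable_outside.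
move=> x; rewrite !indicE.
have sq c : 0 <= c -> c <= `|x| -> b * c ^+ 2 <= b * x ^+ 2.
  move=> c0 cx; apply: ler_wpM2l => //.
  by rewrite -(real_normK (num_real x)) lerXn2r// nnegrE.
have ind_le1 (c : bool) : c%:R <= 1 :> R by case: c.
have [ux|] := leP u `|x|.
  have := sq u (le_trans (ltW v0) vu) ux.
  have := ind_le1 (x \in outside u v); have := ind_le1 (- x \in outside u v).
  lra.
rewrite ltr_norml => /andP[ux xu].
have [vx|] := leP v `|x|.
  have := sq v (ltW v0) vx.
  have : (x \in outside u v)%:R + (- x \in outside u v)%:R <= 1 :> R.
    case: (boolP (x \in outside u v)); last by rewrite add0r.
    rewrite inE => xS; rewrite memNset ?addr0// => xNS.
    by case: xS => /= ?; case: xNS => /= ?; lra.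
  lra.
rewrite ltr_norml => /andP[vx xv].
rewrite !memNset; [|by case=> ?; lra..].
by rewrite addr0 mulr_ge0// addr_ge0// mulr_ge0// sqr_ge0.
Qed.

(** * Lower bound by atoms *)

Lemma preimage_seq_pmf {R : realType} {d : measure_display}
    {T : measurableType d} {P : probability T R} (Z : {RV P >-> R})
    (s : seq R) : uniq s ->
  measurable [set` s] /\ P (Z @^-1` [set` s]) = (\sum_(x <- s) pmf Z x)%:E.
Proof.
have mZ A : measurable A -> measurable (Z @^-1` A).
  by move=> mA; rewrite -[X in measurable X]setTI; exact: measurable_funP.
elim: s => [_|x s IH /= /andP[xs /IH[ms Ps]]].
  by rewrite set_nil preimage_set0 measure0 big_nil; split.
have -> : [set` x :: s] = [set x] `|` [set` s].
  by apply/seteqP; split => y /=; rewrite inE => /predU1P.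
rewrite big_cons; split; first exact: measurableU.
rewrite preimage_setU measureU; [|exact: mZ..|].
- rewrite EFinD fineK; last by apply: fin_num_measure; exact: mZ.
  by congr (_ + _); exact: Ps.
- by rewrite -preimage_setI -subset0 => w [/= ->]; rewrite (negbTE xs).
Qed.

Lemma sum_pmf_le {R : realType} {d : measure_display}
    {T : measurableType d} {P : probability T R} (Z : {RV P >-> R})
    (S : set R) (s : seq R) :
  measurable S -> uniq s -> (forall x, x \in s -> S x) ->
  ((\sum_(x <- s) pmf Z x)%:E <= P (Z @^-1` S))%E.
Proof.
move=> mS us sS; have [ms <-] := preimage_seq_pmf Z s us.
have mZ A : measurable A -> measurable (Z @^-1` A).
  by move=> mA; rewrite -[X in measurable X]setTI; exact: measurable_funP.
by apply: le_measure; rewrite ?inE; [exact: mZ..|move=> w /= /sS].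
Qed.

(** * Existence of the extremal laws *)

Definition four_point_law {R : realType} (p q : {nonneg R}) (a b : R) :
    {measure set R -> \bar R} :=
  measure_add
    (mscale p (measure_add \d_a \d_(- a)))
    (mscale q (measure_add \d_b \d_(- b))).

Lemma ge0_integral_four_point {R : realType} (p q : {nonneg R}) (a b : R)
    (f : R -> R) :
  measurable_fun setT f -> (forall x, 0 <= f x) ->
  (\int[four_point_law p q a b]_x (f x)%:E =
    (p%:num * (f a + f (- a)) + q%:num * (f b + f (- b)))%:E)%E.
Proof.
move=> mf f0.
have mEf : measurable_fun [set: R] (EFin \o f).
  by apply/measurable_EFinP.
rewrite ge0_integral_measure_add//; last by move=> x _; rewrite lee_fin.
rewrite !ge0_integral_mscale//; try by move=> x _; rewrite lee_fin.
rewrite !ge0_integral_measure_add//; try by move=> x _; rewrite lee_fin.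
by rewrite !integral_dirac// !diracT !mul1e.
Qed.

(** Z is the identity of the real line under [four_point_law p q a b]. Taking
    b = 0 puts the mass 2 q at the origin, hence the counting of coincidences
    between a, -a, b, -b and x in the mass at x. *)
Lemma four_point_std_symmetric_masses {R : realType} (p q a b : R)
    (m : seq (R * R)) :
  0 <= p -> 0 <= q -> p + q = 1 / 2 -> 2 * (p * a ^+ 2 + q * b ^+ 2) = 1 ->
  (forall x r, (x, r) \in m ->
     r = p * ((a == x)%:R + (- a == x)%:R) + q * ((b == x)%:R + (- b == x)%:R)) ->
  std_symmetric_masses m.
Proof.
move=> p0 q0 pq1 var1 masses.
pose p' := NngNum p0; pose q' := NngNum q0.
have lawE (A : set R) : four_point_law p' q' a b A =
    (p * ((a \in A)%:R + (- a \in A)%:R) +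
     q * ((b \in A)%:R + (- b \in A)%:R))%:E.
  transitivity (p%:E * (measure_add \d_a \d_(- a))%R A +
                q%:E * (measure_add \d_b \d_(- b))%R A)%E.
    exact: measure_addE.
  by rewrite !measure_addE/= !diracE.
have law1 : four_point_law p' q' a b setT = 1%E.
  rewrite lawE !in_setT (_ : true%:R = 1 :> R)//; congr EFin; lra.
pose P : probability R R := HB.pack (Measure.sort (four_point_law p' q' a b))
  (Measure_isProbability.Build _ _ _ (four_point_law p' q' a b) law1).
pose Z : {RV P >-> R} := HB.pack (@idfun R)
  (isMeasurableFun.Build _ _ _ _ (@idfun R) (@measurable_id _ R setT)).
have EZ : ('E_P[Z] = 0)%E.
  (* The law is invariant under negation, so the positive and negative parts
     of Z have the same finite integral. *)
  rewrite expectation.unlock integralE.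
  have posE x : ((EFin \o @idfun R)^\+ x = (Num.max x 0)%:E)%E.
    by rewrite funeposE /= EFin_max.
  have negE x : ((EFin \o @idfun R)^\- x = (Num.max (- x) 0)%:E)%E.
    by rewrite funenegE /= EFin_max.
  under eq_integral do rewrite posE.
  under [X in (_ - X)%E]eq_integral do rewrite negE.
  have max_ge0 (x : R) : 0 <= Num.max x 0 by rewrite le_max lexx orbT.
  have mmax : measurable_fun setT (fun x : R => Num.max x 0).
    exact: measurable_funrpos.
  have mmaxN : measurable_fun setT (fun x : R => Num.max (- x) 0).
    exact: measurable_funrneg.
  rewrite (ge0_integral_four_point p' q' a b (fun x => Num.max x 0))//.
  rewrite (ge0_integral_four_point p' q' a b (fun x => Num.max (- x) 0))//.
  by rewrite !opprK; congr EFin; lra.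
have VZ : ('V_P[Z] = 1)%E.
  rewrite std_second_moment// (ge0_integral_four_point p' q' a b (fun x => x ^+ 2)).
  - by rewrite /= !sqrrN; congr EFin; lra.
  - exact: measurable_funX.
  - by move=> x; exact: sqr_ge0.
exists _, R, P, Z; split; first split=> // A mA.
- rewrite /distribution /pushforward.
  transitivity (four_point_law p' q' a b A) => //.
  transitivity (four_point_law p' q' a b (-%R @^-1` A)) => //.
  have memN x : (x \in -%R @^-1` A) = (- x \in A) by [].
  by rewrite !lawE !memN !opprK [X in p * X]addrC [X in q * X]addrC.
- move=> x r /masses ->; rewrite /pmf.
  transitivity (fine (four_point_law p' q' a b [set x])) => //.
  by rewrite lawE !classical_sets.in_set1.
Qed.

Lemma three_point_std_symmetric_masses {R : realType} (c : R) :
  0 < c -> 1 <= c ^+ 2 ->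
  std_symmetric_masses [:: (- c, 1 / (2 * c ^+ 2)); (0, 1 - 1 / c ^+ 2);
                           (c, 1 / (2 * c ^+ 2))].
Proof.
move=> c0 c2; have cN0 : c != 0 by rewrite gt_eqF.
set p := 1 / (2 * c ^+ 2).
have pE : 1 / c ^+ 2 = 2 * p by rewrite /p; field.
have pc : p * c ^+ 2 = 1 / 2 by rewrite /p; field.
have p0 : 0 <= p by rewrite /p divr_ge0// mulr_ge0// sqr_ge0.
rewrite pE.
apply: (four_point_std_symmetric_masses p (1 / 2 - p) c 0) => [||||x r];
  try nra.
rewrite !inE => /or3P[] /eqP[-> ->]; rewrite ?opprK ?oppr0 ?eqxx;
  by do ?[case: eqP => [?|_]; first by exfalso; lra]; rewrite /=; lra.
Qed.

(** * The four regimes *)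

Theorem theorem3p2 (R : realType) (d : measure_display) (T : measurableType d)
    (P : probability T R) (Z : {RV P >-> R}) (u v : R)
    (hZ : std_symmetric_rv Z) (hv : 0 < v) (hvu : v <= u) :
  let event := [set w | Z w <= - u \/ v <= Z w] in
  [/\ (u <= 1 ->
        let m := [:: (1, 1 / 2); (- 1, 1 / 2)] in
        [/\ (P event <= 1)%E,
            (has_masses Z m -> P event = 1%E) &
            std_symmetric_masses m]),
      (u <= Num.sqrt 2 * v -> 1 <= u ->
        let m := [:: (- u, 1 / (2 * u ^+ 2));
                     (0, 1 - 1 / u ^+ 2);
                     (u, 1 / (2 * u ^+ 2))] in
        [/\ (P event <= (1 / u ^+ 2)%:E)%E,
            (has_masses Z m -> P event = (1 / u ^+ 2)%:E) &
            std_symmetric_masses m]),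
      (v <= 1 -> 1 < u -> Num.sqrt 2 * v <= u ->
        let p := (1 - v ^+ 2) / (2 * (u ^+ 2 - v ^+ 2)) in
        let q := (u ^+ 2 - 1) / (2 * (u ^+ 2 - v ^+ 2)) in
        let m := [:: (- u, p); (u, p); (- v, q); (v, q)] in
        [/\ (P event <=
              (1 / 2 + (1 - v ^+ 2) / (2 * (u ^+ 2 - v ^+ 2)))%:E)%E,
            (has_masses Z m -> P event =
              (1 / 2 + (1 - v ^+ 2) / (2 * (u ^+ 2 - v ^+ 2)))%:E) &
            std_symmetric_masses m]) &
      (1 <= v -> Num.sqrt 2 * v <= u ->
        let m := [:: (- v, 1 / (2 * v ^+ 2));
                     (0, 1 - 1 / v ^+ 2);
                     (v, 1 / (2 * v ^+ 2))] in
        [/\ (P event <= (1 / (2 * v ^+ 2))%:E)%E,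
            (has_masses Z m -> P event = (1 / (2 * v ^+ 2))%:E) &
            std_symmetric_masses m])].
Proof.
move=> event.
have tail_le := two_sided_tail_le Z u v _ _ hZ hv hvu.
have attained (s : seq R) (B : R) : (P event <= B%:E)%E -> uniq s ->
    (forall x, x \in s -> outside u v x) -> \sum_(x <- s) pmf Z x = B ->
    P event = B%:E.
  move=> PB us sS sumB; apply/le_anti/andP; split => //.
  rewrite -sumB; apply: (sum_pmf_le Z (outside u v)) => //.
  exact: measurable_outside.
have u0 : 0 < u := lt_le_trans hv hvu.
have sqrt2v_ge0 : 0 <= Num.sqrt 2 * v by rewrite mulr_ge0 ?sqrtr_ge0 ?ltW.
have sqrt2v_sq : (Num.sqrt 2 * v) ^+ 2 = 2 * v ^+ 2.
  by rewrite exprMn sqr_sqrtr.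
have sq_le (x y : R) : 0 <= x -> x <= y -> x ^+ 2 <= y ^+ 2.
  by move=> x0 xy; rewrite lerXn2r// nnegrE// (le_trans x0 xy).
split.
- move=> u1 m.
  have bound : (P event <= 1)%E by rewrite -[1]addr0; apply: tail_le; lra.
  split=> // [hm|].
  + apply: (attained [:: 1; -1]) => //.
    * by rewrite /= inE andbT; apply/eqP; lra.
    * by move=> x; rewrite !inE => /orP[] /eqP ->; [right|left]; lra.
    * rewrite !big_cons big_nil (hm 1 (1 / 2)) ?(hm (-1) (1 / 2));
        rewrite ?inE ?eqxx ?orbT//; lra.
  + apply: (four_point_std_symmetric_masses (1 / 2) 0 1 0) => [||||x r];
      try lra.
    rewrite !inE => /orP[] /eqP[-> ->]; rewrite ?opprK ?oppr0 ?eqxx;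
      by do ?[case: eqP => [?|_]; first by exfalso; lra]; rewrite /=; lra.
- move=> uv u1 m.
  have u2 : 1 <= u ^+ 2 by rewrite exprn_ege1.
  have uv2 : u ^+ 2 <= 2 * v ^+ 2 by rewrite -sqrt2v_sq sq_le// ltW.
  have uN0 : u != 0 by rewrite gt_eqF.
  set b := 1 / u ^+ 2.
  have bu : b * u ^+ 2 = 1 by rewrite /b; field.
  have b0 : 0 <= b by rewrite /b divr_ge0// sqr_ge0.
  have buv : b * u ^+ 2 <= b * (2 * v ^+ 2) by apply: ler_wpM2l.
  have bound : (P event <= b%:E)%E by rewrite -[b]add0r; apply: tail_le; lra.
  split=> // [hm|]; last exact: three_point_std_symmetric_masses.
  apply: (attained [:: - u; u]) => //.
  + by rewrite /= inE andbT; apply/eqP; lra.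
  + by move=> x; rewrite !inE => /orP[] /eqP ->; [left|right].
  + rewrite !big_cons big_nil (hm u (1 / (2 * u ^+ 2)));
      rewrite ?(hm (- u) (1 / (2 * u ^+ 2))) ?inE ?eqxx ?orbT//.
    by rewrite /b; field.
- move=> v1 u1 uv p q m.
  have u2 : 1 < u ^+ 2 by rewrite exprn_egt1.
  have v2 : v ^+ 2 <= 1 by rewrite exprn_ile1// ltW.
  have uv2 : 2 * v ^+ 2 <= u ^+ 2 by rewrite -sqrt2v_sq sq_le.
  have vltu : v < u by have v20 := exprn_gt0 2 hv; nra.
  have D0 : u ^+ 2 - v ^+ 2 != 0 by rewrite gt_eqF//; lra.
  (* The majorant a + b x ^ 2 equal to 1/2 at v and to 1 at u has
     leading coefficient b. *)
  set b := 1 / (2 * (u ^+ 2 - v ^+ 2)).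
  have bD : b * (u ^+ 2 - v ^+ 2) = 1 / 2 by rewrite /b; field.
  have b0 : 0 <= b by rewrite /b divr_ge0// mulr_ge0//; lra.
  have pE : p = b * (1 - v ^+ 2) by rewrite /p /b; field.
  have qE : q = b * (u ^+ 2 - 1) by rewrite /q /b; field.
  have p0 : 0 <= p by rewrite pE mulr_ge0//; lra.
  have q0 : 0 <= q by rewrite qE mulr_ge0//; lra.
  have pq : p + q = 1 / 2 by rewrite pE qE; lra.
  have bound : (P event <= (1 / 2 + p)%:E)%E.
    rewrite (_ : 1 / 2 + p = (1 / 2 - b * v ^+ 2) + b); last by rewrite pE; ring.
    have bv : b * v ^+ 2 <= b * (u ^+ 2 - v ^+ 2) by apply: ler_wpM2l => //; lra.
    by apply: tail_le => //; lra.
  split=> // [hm|].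
  + apply: (attained [:: - u; u; v]) => //.
    * rewrite /= !inE andbT negb_or -!andbA.
      by apply/and3P; split; apply/eqP; lra.
    * by move=> x; rewrite !inE => /or3P[] /eqP ->; [left|right|right].
    * rewrite !big_cons big_nil (hm u p) ?(hm (- u) p) ?(hm v q);
        rewrite ?inE ?eqxx ?orbT// -/p; lra.
  + apply: (four_point_std_symmetric_masses p q u v) => [||||x r] //.
      by rewrite pE qE; lra.
    rewrite !inE => /or4P[] /eqP[-> ->]; rewrite ?opprK ?eqxx;
      by do ?[case: eqP => [?|_]; first by exfalso; lra]; rewrite /=; lra.
- move=> v1 uv m.
  have v2 : 1 <= v ^+ 2 by rewrite exprn_ege1.
  have uv2 : 2 * v ^+ 2 <= u ^+ 2 by rewrite -sqrt2v_sq sq_le.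
  have vN0 : v != 0 by rewrite gt_eqF.
  set p := 1 / (2 * v ^+ 2) in m *.
  have pv : p * (2 * v ^+ 2) = 1 by rewrite /p; field.
  have p0 : 0 <= p by rewrite /p divr_ge0// mulr_ge0// sqr_ge0.
  have puv : p * (2 * v ^+ 2) <= p * u ^+ 2 by apply: ler_wpM2l.
  have bound : (P event <= p%:E)%E by rewrite -[p]add0r; apply: tail_le; lra.
  split=> // [hm|]; last exact: three_point_std_symmetric_masses.
  apply: (attained [:: v]) => //.
  + by move=> x; rewrite !inE => /eqP ->; right.
  + by rewrite big_cons big_nil (hm v p) ?addr0 ?inE ?eqxx ?orbT.
Qed.
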